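(* There exist universal constants $0<c\le C$ such that for all integers $n\ge k\ge 2$ and $r\ge 0$, \[ c\,k(\log_k n + r)\le \mathsf{opt}_{\operatorname{bandit}}^{\operatorname{adap}}(n,k,r)\le C\,k(\log_k n+r). \] Furthermore, for every constant $C_0>0$ there exist constants $0<c'\le C'$ depending only on $C_0$ such that whenever $n\ge k\ge 2$, $r\ge 0$ and $r\le C_0\log_k n$, \[ c'\,k\log_k n\le \mathsf{opt}_{\operatorname{bandit}}^{\operatorname{obl}}(n,k,r)\le C'\,k\log_k n. \]
   Context: Prediction with expert advice, $n$ experts, $k$ labels: let $\mathcal{Y}=\{1,\dots,k\}$, $\mathcal{X}=[k]^n$, and $\mathcal{U}_{n,k}=\{h_1,\dots,h_n\}$ with $h_i(x)=x_i$. For $r\ge0$ let $\mathcal{P}_r$ be the set of finite sequences $p$ of examples in $\mathcal{X}\times\mathcal{Y}$ such that some $h_i$ satisfies $h_i(x)\neq y$ for at most $r$ examples $(x,y)$ of $p$. Online learning with bandit feedback: in rounds $t=1,2,\dots$ the adversary presents $x_t$, the learner draws $\hat y_t$ from a distribution $\pi^{(t)}$ depending on past observations and $x_t$, and observes only whether $\hat y_t=y_t$ (true label); a mistake is $\hat y_t\ne y_t$. Oblivious: the adversary fixes $S\in\mathcal{P}_r$ in advance; $\mathsf{opt}_{\operatorname{bandit}}^{\operatorname{obl}}(n,k,r)=\inf_{\text{learner}}\sup_{S\in\mathcal{P}_r}$ expected mistakes. Adaptive: each round the adversary picks $x_t$ from the history, sees $\pi^{(t)}$, and picks a distribution $\tau^{(t)}$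 of $y_t$ ($\hat y_t\sim\pi^{(t)}$, $y_t\sim\tau^{(t)}$), subject to: whenever the history is realizable, every $y_t$ in the support of $\tau^{(t)}$ keeps it realizable, where a history of (instance, correct/incorrect, prediction) triples is realizable if some choice of true labels agreeing with all observations yields a sequence in $\mathcal{P}_r$ (i.e. some expert is inconsistent with the bandit feedback in at most $r$ rounds). $\mathsf{opt}_{\operatorname{bandit}}^{\operatorname{adap}}(n,k,r)=\inf_{\text{learner}}\sup_{\text{adversary}}$ expected mistakes. *)

(* Defs.v *)
From HB Require Import structures.
From mathcomp Require Import all_boot all_order all_algebra.
From mathcomp Require Import all_classical all_reals ereal exp.
From mathcomp Require Import Rstruct.
From Stdlib Require Rdefinitions.

Set Implicit Arguments.
Unset Strict Implicit.
Unset Printing Implicit Defensive.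
Import Order.TTheory GRing.Theory Num.Theory.
Local Open Scope ring_scope.
Local Open Scope classical_set_scope.

Notation R := Rdefinitions.R.

Section Bandit.
Variables (n k : nat).

Definition inst := {ffun 'I_n -> 'I_k}.
Definition expert (i : 'I_n) (x : inst) : 'I_k := x i.

Definition in_P (r : nat) (S : seq (inst * 'I_k)) : Prop :=
  exists i : 'I_n, (count (fun e => expert i e.1 != e.2) S <= r)%N.

Definition is_dist (p : {ffun 'I_k -> R}) : Prop :=
  (forall y, 0 <= p y) /\ \sum_(y : 'I_k) p y = 1.

(* what the learner observes: (instance, prediction, correct?) *)
Definition obs := (inst * 'I_k * bool)%type.

(* a (randomized) bandit learner: distribution of the prediction at round t
   as a function of past observations and the current instance x_t *)
Definition learner := seq obs -> inst -> {ffun 'I_k -> R}.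
Definition valid_learner (L : learner) : Prop :=
  forall h x, is_dist (L h x).

Fixpoint exp_mistakes_obl (L : learner) (hv : seq obs) (S : seq (inst * 'I_k))
  : R :=
  match S with
  | [::] => 0
  | (x, y) :: S' =>
      \sum_(yh : 'I_k) L hv x yh *
        ((yh != y)%:R + exp_mistakes_obl L (rcons hv (x, yh, yh == y)) S')
  end.

Definition opt_obl (r : nat) : \bar R :=
  ereal_inf [set ereal_sup [set (exp_mistakes_obl L [::] S)%:E | S in in_P r]
            | L in valid_learner].

Definition realizable (r : nat) (hv : seq obs) : Prop :=
  exists ys : seq 'I_k,
    all2 (fun (o : obs) (y : 'I_k) => (o.1.2 == y) == o.2) hv ys /\
    in_P r (zip (map (fun o : obs => o.1.1) hv) ys).

(* full history (instance, prediction, true label), known to the adversary *)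
Definition fobs := (inst * 'I_k * 'I_k)%type.
Definition view (h : seq fobs) : seq obs :=
  map (fun e : fobs => (e.1.1, e.1.2, e.1.2 == e.2)) h.

(* adaptive adversary: chooses x_t from the history, then, seeing pi^(t),
   a distribution tau^(t) of the true label y_t *)
Record adversary := Adversary {
  adv_x : seq fobs -> inst;
  adv_y : seq fobs -> {ffun 'I_k -> R} -> {ffun 'I_k -> R} }.

Definition valid_adversary (r : nat) (L : learner) (A : adversary) : Prop :=
  (forall h p, is_dist (adv_y A h p)) /\
  (forall h, realizable r (view h) ->
     let x := adv_x A h in
     let p := L (view h) x in
     forall yh y, 0 < p yh -> 0 < adv_y A h p y ->
       realizable r (view (rcons h (x, yh, y)))).

Fixpoint exp_mistakes_adap (L : learner) (A : adversary) (T : nat)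
    (h : seq fobs) : R :=
  match T with
  | 0 => 0
  | T'.+1 =>
      let x := adv_x A h in
      let p := L (view h) x in
      let q := adv_y A h p in
      \sum_(yh : 'I_k) \sum_(y : 'I_k) p yh * q y *
        ((yh != y)%:R + exp_mistakes_adap L A T' (rcons h (x, yh, y)))
  end.

(* the game has rounds t = 1, 2, ...; the expected total number of mistakes is
   the supremum over horizons T of the expected mistakes in the first T rounds
   (monotone convergence) *)
Definition opt_adap (r : nat) : \bar R :=
  ereal_inf [set ereal_sup [set (exp_mistakes_adap L AT.1 AT.2 [::])%:E
                           | AT in [set AT : adversary * nat |
                                    valid_adversary r L AT.1]]
            | L in valid_learner].
End Bandit.

Definition logb (k n : nat) : R := ln (n%:R : R) / ln (k%:R : R).

(* Main.v *)
(** The weight of an expert is [k ^ - c] where [c] counts the rounds in which the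
    bandit feedback contradicts it, and [W] is the total weight. The learner
    predicts the plurality label when its share of [W] is at least
    [ln k / (2 k)] and guesses uniformly otherwise. In the first case a mistake
    multiplies [W] by at most [1 - ln k / (4 k)]; in the second one a correct
    guess, of probability [1 / k], multiplies [W] by at most [1 / sqrt k]. Hence
    the mistakes made so far plus the potential
    [4 k / ln k * (ln W + r ln k)] form a supermartingale for every label, and
    the potential is nonnegative as long as the history is realizable.

    For the lower bounds in [log_k n], write the experts in base [k] and present
    each of the [trunc_log k n] digits [k] times with a uniformly random label:
    each digit costs [(k - 1) / 2] mistakes on average. For the lower bound in
    [r], let [k] experts predict distinct labels and let the adversary use a
    label that the learner predicts with probability at most [1 / k]: a round
    adds at most two contradictions on average, and [k r + 1] of them are needed
    before all [k] experts can be eliminated. *)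

Require Import Defs.
From mathcomp Require Import all_boot all_order all_algebra.
From mathcomp Require Import all_classical all_reals ereal exp.
From mathcomp Require Import Rstruct.
From mathcomp Require Import zify ring lra.
Import Order.TTheory GRing.Theory Num.Theory.
Local Open Scope ring_scope.
Set Implicit Arguments.
Unset Strict Implicit.
Unset Printing Implicit Defensive.

(** * Realizability as a count of contradictions with the feedback *)

Definition inconsistent n k (i : 'I_n) (o : obs n k) : bool :=
  (o.1.1 i == o.1.2) != o.2.

Definition charges n k (i : 'I_n) (hv : seq (obs n k)) : nat :=
  count (inconsistent i) hv.

Lemma charges_rcons n k (i : 'I_n) (hv : seq (obs n k)) o :
  charges i (rcons hv o) = (charges i hv + inconsistent i o)%N.
Proof. by rewrite /charges -cats1 count_cat /= addn0. Qed.

(* The true label is taken to be the prediction of the expert whenever the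
   observation allows it; otherwise [1 < k] provides another wrong label. *)
Lemma label_of_obs n k (i : 'I_n) (o : obs n k) : (1 < k)%N ->
  exists y, ((o.1.2 == y) == o.2) /\ (expert i o.1.1 != y) = inconsistent i o.
Proof.
case: o => [[x z] []] k1; rewrite /expert /inconsistent /=.
  by exists z; rewrite eqxx; case: (x i == z).
have [xz|xz] := eqVneq (x i) z; last first.
  by exists (x i); rewrite eqxx [z == _]eq_sym (negbTE xz).
have /card_gt0P[y] : (0 < #|[set~ z]|)%N by rewrite cardsC1 card_ord; lia.
rewrite !inE => yz; exists y.
by rewrite xz [z == y]eq_sym (negbTE yz).
Qed.

(** A contradicted expert errs under every labelling that agrees with the feedback; conversely,
    labels can be chosen round by round so that a given expert errs only where it is
    contradicted. *)
Lemma realizableP n k r (hv : seq (obs n k)) : (1 < k)%N ->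
  realizable r hv <-> exists i, (charges i hv <= r)%N.
Proof.
move=> k1; split.
  move=> [ys [ok [i le_r]]]; exists i; apply: leq_trans le_r.
  elim: hv ys ok => [|[[x z] b] hv IH] [|y ys] //= /andP[/eqP <- /IH].
  move=> le; apply: leq_add => //; rewrite /inconsistent /expert /=.
  by case: (eqVneq z y) => [<-|zy]; case: (eqVneq (x i) z) => // ->; rewrite zy.
move=> [i le_r].
suff [ys [ok eq_c]] : exists ys, all2 (fun o y => (o.1.2 == y) == o.2) hv ys /\
    count (fun e => expert i e.1 != e.2) (zip [seq o.1.1 | o <- hv] ys)
      = charges i hv.
  by exists ys; split=> //; exists i; rewrite eq_c.
elim: hv {le_r} => [|o hv [ys [ok eq_c]]]; first by exists [::].
have [y [oy yo]] := label_of_obs i o k1.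
by exists (y :: ys) => /=; rewrite oy ok yo eq_c.
Qed.

(** * Point masses and the uniform distribution *)

Lemma sum_const_ord k (a : R) : \sum_(y < k) a = k%:R * a.
Proof. by rewrite sumr_const card_ord mulr_natl. Qed.

Definition dirac k (y : 'I_k) : {ffun 'I_k -> R} := [ffun z => (z == y)%:R].

Lemma sum_dirac k (y : 'I_k) (F : 'I_k -> R) : \sum_z dirac y z * F z = F y.
Proof.
rewrite (bigD1 y) //= ffunE eqxx mul1r big1 ?addr0 // => z zy.
by rewrite ffunE (negbTE zy) mul0r.
Qed.

Lemma dirac_gt0 k (y z : 'I_k) : 0 < dirac y z -> z = y.
Proof. by rewrite ffunE; case: eqP => // _; rewrite ltxx. Qed.

Lemma dirac_is_dist k (y : 'I_k) : is_dist (dirac y).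
Proof.
split=> [z|]; first by rewrite ffunE ler0n.
by rewrite -[RHS](sum_dirac y (fun=> 1)); apply: eq_bigr => z _; rewrite mulr1.
Qed.

Definition uniform k : {ffun 'I_k -> R} := [ffun => k%:R^-1].

Lemma uniform_is_dist k : (0 < k)%N -> is_dist (uniform k).
Proof.
move=> k0; split=> [z|]; first by rewrite ffunE invr_ge0 ler0n.
under eq_bigr do rewrite ffunE.
by rewrite sum_const_ord divff // pnatr_eq0; lia.
Qed.

(** * The plurality learner *)

Definition weight n k (hv : seq (obs n k)) (i : 'I_n) : R :=
  k%:R^-1 ^+ charges i hv.

Definition total n k (hv : seq (obs n k)) : R := \sum_i weight hv i.

Definition group n k (hv : seq (obs n k)) (x : inst n k) (y : 'I_k) : R :=
  \sum_(i | x i == y) weight hv i.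

Definition share n k (hv : seq (obs n k)) x y : R := group hv x y / total hv.

Lemma weight_gt0 n k (hv : seq (obs n k)) i : (1 < k)%N -> 0 < weight hv i.
Proof. by move=> k1; rewrite exprn_gt0 // invr_gt0 ltr0n; lia. Qed.

Lemma total_gt0 n k (hv : seq (obs n k)) : (1 < k)%N -> (0 < n)%N ->
  0 < total hv.
Proof.
move=> k1 n0; rewrite /total (bigD1 (Ordinal n0)) //=.
by rewrite ltr_wpDr ?weight_gt0 // sumr_ge0 // => i _; rewrite ltW ?weight_gt0.
Qed.

Lemma group_ge0 n k (hv : seq (obs n k)) x y : (1 < k)%N -> 0 <= group hv x y.
Proof. by move=> k1; rewrite sumr_ge0 // => i _; rewrite ltW ?weight_gt0. Qed.

Lemma group_le_total n k (hv : seq (obs n k)) x y : (1 < k)%N ->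
  group hv x y <= total hv.
Proof.
move=> k1; rewrite /total (bigID (fun i => x i == y)) /= lerDl sumr_ge0 //.
by move=> i _; rewrite ltW ?weight_gt0.
Qed.

Lemma total_rcons n k (hv : seq (obs n k)) x y b :
  total (rcons hv (x, y, b)) =
  if b then group hv x y + (total hv - group hv x y) / k%:R
  else total hv - group hv x y + group hv x y / k%:R.
Proof.
have -> : total hv - group hv x y = \sum_(i | x i != y) weight hv i.
  rewrite /total (bigID (fun i => x i == y)) /= -/(group hv x y).
  by rewrite addrAC subrr add0r.
have w_rcons i : weight (rcons hv (x, y, b)) i =
    if (x i == y) == b then weight hv i else weight hv i / k%:R.
  rewrite /weight charges_rcons /inconsistent /=.
  by case: (_ == b); rewrite ?addn0 // addn1 exprSr.
rewrite /total (bigID (fun i => x i == y)) /=; case: b w_rcons => w_rcons.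
  congr (_ + _); last rewrite mulr_suml; apply: eq_bigr => i; rewrite w_rcons.
    by move=> ->.
  by move=> /negbTE ->.
rewrite addrC; congr (_ + _); last rewrite mulr_suml.
  by apply: eq_bigr => i; rewrite w_rcons => /negbTE ->.
by apply: eq_bigr => i; rewrite w_rcons => ->.
Qed.

Definition potential n k (r : nat) (hv : seq (obs n k)) : R :=
  4 * k%:R / ln k%:R * (ln (total hv) + r%:R * ln k%:R).

Lemma ln_nat_gt0 k : (1 < k)%N -> 0 < ln (k%:R : R).
Proof. by move=> k1; rewrite ln_gt0 // ltr1n. Qed.

Lemma potential_nil n k r : (1 < k)%N -> (0 < n)%N ->
  potential r (Nil (obs n k)) = 4 * k%:R * (logb k n + r%:R).
Proof.
move=> k1 n0; have := ln_nat_gt0 k1; rewrite /potential /logb.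
have -> : total (Nil (obs n k)) = n%:R.
  by rewrite /total (eq_bigr (fun=> 1)) // sumr_const card_ord.
by move=> l0; field; rewrite gt_eqF.
Qed.

(** The expert [i] alone keeps weight at least [k ^ - r], so [ln (total hv)] is at least
    [- r ln k]. *)
Lemma potential_ge0 n k r (hv : seq (obs n k)) i : (1 < k)%N ->
  (charges i hv <= r)%N -> 0 <= potential r hv.
Proof.
move=> k1 le_r; have l0 := ln_nat_gt0 k1.
have k0 : 0 < k%:R :> R by rewrite ltr0n; lia.
have c0 : 0 <= 4 * k%:R / ln (k%:R : R) by rewrite divr_ge0 ?mulr_ge0 // ltW.
rewrite mulr_ge0 //.
have le_w : weight hv i <= total hv.
  by rewrite /total (bigD1 i) //= lerDl sumr_ge0 // => j _; rewrite ltW ?weight_gt0.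
have : ln (weight hv i) <= ln (total hv).
  by rewrite ler_ln // posrE ?(lt_le_trans _ le_w) ?weight_gt0.
rewrite /weight lnXn ?invr_gt0 // lnV ?posrE // -[_ *+ charges i hv]mulr_natl mulrN.
have : (charges i hv)%:R * ln (k%:R : R) <= r%:R * ln k%:R.
  by rewrite ler_wpM2r ?ler_nat // ltW.
lra.
Qed.

(** The group of [y] loses a fraction [1 - 1/k >= 1/2] of its weight, and [ln (1 - u) <= - u]. *)
Lemma ln_total_mistake n k (hv : seq (obs n k)) x y : (1 < k)%N -> (0 < n)%N ->
  ln (total (rcons hv (x, y, false))) <= ln (total hv) - share hv x y / 2.
Proof.
move=> k1 n0; have T0 := total_gt0 hv k1 n0.
have T'0 := total_gt0 (rcons hv (x, y, false)) k1 n0.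
have g0 := group_ge0 hv x y k1.
have k2 : (k%:R^-1 : R) <= 2^-1 by rewrite lef_pV2 ?posrE ?ltr0n ?ler_nat //; lia.
have le1 : total (rcons hv (x, y, false)) / total hv <= 1 + - (share hv x y / 2).
  rewrite ler_pdivrMr // total_rcons /share.
  have -> : (1 + - (group hv x y / total hv / 2)) * total hv =
      total hv - group hv x y / 2 by field; rewrite gt_eqF.
  have : group hv x y / k%:R <= group hv x y * 2^-1 by rewrite ler_wpM2l.
  lra.
have q0 : 0 < total (rcons hv (x, y, false)) / total hv by rewrite divr_gt0.
have : ln (total (rcons hv (x, y, false)) / total hv) <= - (share hv x y / 2).
  apply: (@le_trans _ _ (ln (1 + - (share hv x y / 2)))).
    by rewrite ler_ln // posrE // (lt_le_trans q0).
  by apply: le_ln1Dx; lra.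
rewrite ln_div ?posrE //; lra.
Qed.

Lemma ln_total_correct n k (hv : seq (obs n k)) x y : (1 < k)%N -> (0 < n)%N ->
  ln (total (rcons hv (x, y, true))) <=
  ln (total hv) + ln (share hv x y + k%:R^-1).
Proof.
move=> k1 n0; have T0 := total_gt0 hv k1 n0.
have T'0 := total_gt0 (rcons hv (x, y, true)) k1 n0.
have g0 := group_ge0 hv x y k1.
have ki : 0 < (k%:R^-1 : R) by rewrite invr_gt0 ltr0n; lia.
have s0 : 0 <= share hv x y by rewrite divr_ge0 // ltW.
rewrite -lnM ?posrE ?ler_ln ?posrE ?mulr_gt0 //; try lra.
rewrite total_rcons mulrDr [total hv * share _ _ _]mulrC divfK ?gt_eqF //.
by rewrite lerD2l ler_wpM2r ?(ltW ki) //; lra.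
Qed.

Lemma total_rcons_le n k (hv : seq (obs n k)) o : (1 < k)%N ->
  total (rcons hv o) <= total hv.
Proof.
move=> k1; apply: ler_sum => i _; rewrite /weight charges_rcons exprD.
rewrite ler_piMr ?exprn_ge0 ?invr_ge0 ?ler0n // exprn_ile1 ?invr_ge0 ?ler0n //.
by rewrite invf_le1 ?ltr0n ?ler1n; lia.
Qed.

(** Any label above the threshold will do; it need not be the heaviest one. *)
Definition plurality_learner n k : learner n k := fun hv x =>
  if [pick y | ln (k%:R : R) / (2 * k%:R) <= share hv x y] is Some y
  then dirac y else uniform k.

Lemma plurality_learner_valid n k : (1 < k)%N ->
  valid_learner (@plurality_learner n k).
Proof.
move=> k1 hv x; rewrite /plurality_learner; case: pickP => [y _|_].
  exact: dirac_is_dist.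
by apply: uniform_is_dist; lia.
Qed.

Lemma potential_step n k r (hv : seq (obs n k)) x y : (1 < k)%N -> (0 < n)%N ->
  \sum_yh plurality_learner hv x yh *
     ((yh != y)%:R + potential r (rcons hv (x, yh, yh == y)))
  <= potential r hv.
Proof.
move=> k1 n0; have l0 := ln_nat_gt0 k1.
have k0 : 0 < k%:R :> R by rewrite ltr0n; lia.
pose B : R := 4 * k%:R / ln k%:R.
have B0 : 0 < B by rewrite divr_gt0 ?mulr_gt0.
have T0 := total_gt0 hv k1 n0.
have pot_le o : potential r (rcons hv o) <= potential r hv.
  rewrite ler_wpM2l ?(ltW B0) // lerD2r ler_ln ?posrE ?total_gt0 //.
  exact: total_rcons_le.
rewrite /plurality_learner; case: pickP => [z zP|small].
  rewrite sum_dirac; have [_|zy] := eqVneq z y; first by rewrite add0r pot_le.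
  rewrite /potential -/B.
  have : B * ln (total (rcons hv (x, z, false))) <=
      B * (ln (total hv) - share hv x z / 2).
    by rewrite ler_wpM2l ?(ltW B0) // ln_total_mistake.
  have : B * (ln (k%:R : R) / (2 * k%:R)) <= B * share hv x z.
    by rewrite ler_wpM2l ?(ltW B0).
  (* This fixes the factor 4: a wrong prediction lowers the potential by at least half of this 2,
     which pays for the mistake. *)
  have -> : B * (ln (k%:R : R) / (2 * k%:R)) = 2.
    by rewrite /B; field; rewrite !gt_eqF.
  rewrite /=; lra.
have correct : potential r (rcons hv (x, y, true)) <= potential r hv - 2 * k%:R.
  have s_lt : share hv x y < ln (k%:R : R) / (2 * k%:R).
    by rewrite ltNge small.
  have s0 : 0 <= share hv x y by rewrite divr_ge0 ?group_ge0 // ltW.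
  have ki : 0 < (k%:R^-1 : R) by rewrite invr_gt0.
  (* Below the threshold the argument is less than [(1 + ln k / 2) / k], and [ln (1 + u) <= u] gives
     back half of [ln k]. *)
  have ln_le : ln (share hv x y + k%:R^-1) <= - (ln (k%:R : R) / 2).
    apply: (@le_trans _ _ (ln ((1 + ln (k%:R : R) / 2) / k%:R))).
      rewrite ler_ln ?posrE //; [|lra|by rewrite divr_gt0 //; lra].
      have -> : (1 + ln (k%:R : R) / 2) / k%:R = ln k%:R / (2 * k%:R) + k%:R^-1.
        by field; rewrite gt_eqF.
      by rewrite lerD2r ltW.
    rewrite ln_div ?posrE //; last lra.
    have : ln (1 + ln (k%:R : R) / 2) <= ln k%:R / 2 by apply: le_ln1Dx; lra.
    lra.
  have := ln_total_correct hv x y k1 n0.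
  rewrite /potential -/B => le1.
  have : B * ln (total (rcons hv (x, y, true))) <=
      B * (ln (total hv) - ln (k%:R : R) / 2).
    by rewrite ler_wpM2l ?(ltW B0) //; lra.
  have : B * (ln (k%:R : R) / 2) = 2 * k%:R by rewrite /B; field; rewrite gt_eqF.
  lra.
(* The [k - 1] wrong guesses cost one mistake each, against the drop of [2 k] at the correct one. *)
under eq_bigr do rewrite ffunE.
rewrite -mulr_sumr ler_pdivrMl // (bigD1 y) //= eqxx add0r.
have : \sum_(z | z != y) ((z != y)%:R + potential r (rcons hv (x, z, z == y)))
    <= \sum_(z | z != y) (1 + potential r hv).
  apply: ler_sum => z /negbTE zy; rewrite zy lerD2l; exact: pot_le.
have card_le : (#|[pred z : 'I_k | z != y]|).+1 = k.
  by have := cardC1 y; rewrite card_ord => ->; lia.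
have -> : \sum_(z | z != y) (1 + potential r hv) =
    (k%:R - 1) * (1 + potential r hv).
  rewrite sumr_const -[LHS]mulr_natl; congr (_ * _).
  by rewrite -[in RHS]card_le -natr1 addrK.
move: correct k0; lra.
Qed.

(** The budget is preserved since the feedback charges an expert only in a round where it errs on
    the true label. *)
Lemma exp_mistakes_obl_le n k r (i : 'I_n) S (hv : seq (obs n k)) : (1 < k)%N ->
  (charges i hv + count (fun e => expert i e.1 != e.2) S <= r)%N ->
  exp_mistakes_obl (@plurality_learner n k) hv S <= potential r hv.
Proof.
move=> k1; elim: S hv => [|[x y] S IH] hv /= le_r.
  by apply: (potential_ge0 (i := i)); lia.
have n0 : (0 < n)%N by case: i {IH le_r} => i /= /(leq_trans (ltn0Sn _)).
apply: le_trans (potential_step r hv x y k1 n0).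
apply: ler_sum => z _; rewrite ler_wpM2l //.
  by have [] := plurality_learner_valid k1 hv x.
rewrite lerD2l IH //; apply: leq_trans le_r.
rewrite charges_rcons -addnA leq_add2l leq_add2r /inconsistent /expert /=.
by case: (eqVneq z y) => [<-|zy]; case: (eqVneq (x i) z) => // ->; rewrite zy.
Qed.

Lemma exp_mistakes_adap_le n k r (A : adversary n k) T h : (1 < k)%N ->
  valid_adversary r (@plurality_learner n k) A -> realizable r (view h) ->
  exp_mistakes_adap (@plurality_learner n k) A T h <= potential r (view h).
Proof.
move=> k1 [distA validA]; elim: T h => [|T IH] h real_h /=.
  by have [i] := (realizableP r (view h) k1).1 real_h; apply: potential_ge0.
have n0 : (0 < n)%N.
  have [[i lt_i] _] := (realizableP r (view h) k1).1 real_h.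
  exact: leq_trans (ltn0Sn _) lt_i.
set x := adv_x A h; set p := plurality_learner _ _; set q := adv_y A h p.
have [p0 _] : is_dist p by apply: plurality_learner_valid.
have [q0 q1] : is_dist q by apply: distA.
(* Condition on the label first: [potential_step] holds for each label, hence on average over
   [q]. *)
rewrite exchange_big /=.
apply: (@le_trans _ _ (\sum_y q y * potential r (view h))); last first.
  by rewrite -mulr_suml q1 mul1r.
apply: ler_sum => y _.
apply: (@le_trans _ _ (q y * \sum_yh p yh *
     ((yh != y)%:R + potential r (rcons (view h) (x, yh, yh == y))))); last first.
  by rewrite ler_wpM2l // potential_step.
rewrite mulr_sumr; apply: ler_sum => yh _.
rewrite [q y * _]mulrCA mulrA.
(* Validity constrains only outcomes of positive probability; the others contribute nothing. *)
have [->|pz] := eqVneq (p yh) 0; first by rewrite !mul0r.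
have [->|qz] := eqVneq (q y) 0; first by rewrite !mulr0 !mul0r.
rewrite ler_wpM2l ?mulr_ge0 // lerD2l.
have -> : rcons (view h) (x, yh, yh == y) = view (rcons h (x, yh, y)).
  by rewrite /view map_rcons.
by apply/IH/validA; rewrite // lt0r ?pz ?qz ?p0 ?q0.
Qed.

Lemma opt_obl_le n k r : (1 < k)%N -> (0 < n)%N ->
  (opt_obl n k r <= (4 * k%:R * (logb k n + r%:R))%:E)%E.
Proof.
move=> k1 n0; apply: ge_ereal_inf; eexists.
  by exists (@plurality_learner n k) => //; exact: plurality_learner_valid.
apply: ge_ereal_sup => _ [S [i le_r] <-].
by rewrite lee_fin -potential_nil // (exp_mistakes_obl_le (i := i)).
Qed.

Lemma opt_adap_le n k r : (1 < k)%N -> (0 < n)%N ->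
  (opt_adap n k r <= (4 * k%:R * (logb k n + r%:R))%:E)%E.
Proof.
move=> k1 n0; apply: ge_ereal_inf; eexists.
  by exists (@plurality_learner n k) => //; exact: plurality_learner_valid.
apply: ge_ereal_sup => _ [[A T] /= validA <-].
rewrite lee_fin -potential_nil //; apply: (exp_mistakes_adap_le _ k1 validA).
by apply/realizableP => //; exists (Ordinal n0).
Qed.

(** * Random digits *)

(** Expectation over uniform label sequences of length [m]; the recursion peels off one label per
    block. *)
Fixpoint avg k (m : nat) (F : seq 'I_k -> R) : R :=
  if m is m'.+1 then k%:R^-1 * \sum_y avg m' (fun ys => F (y :: ys)) else F [::].

Lemma avg_linear k m (p a : 'I_k -> R) (F : 'I_k -> seq 'I_k -> R) : (0 < k)%N ->
  avg m (fun ys => \sum_z p z * (a z + F z ys)) =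
  \sum_z p z * (a z + avg m (F z)).
Proof.
move=> k0; have kn0 : k%:R != 0 :> R by rewrite pnatr_eq0; lia.
elim: m F => [//|m IH] F /=.
under eq_bigr do rewrite IH.
rewrite exchange_big mulr_sumr; apply: eq_bigr => z _ /=.
rewrite -mulr_sumr big_split /= sumr_const card_ord -[a z *+ k]mulr_natl.
by rewrite mulrCA mulrDr mulKf.
Qed.

Lemma exists_ge_avg k m (F : seq 'I_k -> R) a : (0 < k)%N -> a <= avg m F ->
  exists ys, size ys = m /\ a <= F ys.
Proof.
move=> k0; elim: m F => [|m IH] F /= le_a; first by exists [::].
have [y le_y|lt_a] := pickP (fun y => a <= avg m (fun ys => F (y :: ys))).
  by have [ys [<- le_F]] := IH _ le_y; exists (y :: ys).
suff : k%:R^-1 * \sum_y avg m (fun ys => F (y :: ys)) < a.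
  by rewrite ltNge le_a.
rewrite ltr_pdivrMl ?ltr0n // -sum_const_ord.
apply: ltr_sum => [|y _]; last by rewrite ltNge lt_a.
by apply/hasP; exists (Ordinal k0) => //; rewrite mem_index_enum.
Qed.

(* While guesses are wrong they eliminate at most one label of [W] each, so
   the first [#|W|] guesses are wrong for [#|W| - 1], [#|W| - 2], ... labels. *)
Lemma block_lower n k (L : learner n k) x (g : R)
    (E : nat -> seq (obs n k) -> 'I_k -> R) :
  valid_learner L ->
  (forall hv y, g <= E 0%N hv y) ->
  (forall t hv y, E t.+1 hv y =
     \sum_yh L hv x yh * ((yh != y)%:R + E t (rcons hv (x, yh, yh == y)) y)) ->
  forall t hv (W : {set 'I_k}), (#|W| <= t)%N ->
  #|W|%:R * g + ('C(#|W|, 2))%:R <= \sum_(y in W) E t hv y.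
Proof.
move=> validL E0 ES.
(* Mistakes are nonnegative, so extra rounds cannot bring the value below [g]. *)
have E_ge t hv y : g <= E t hv y.
  elim: t hv => [|t IH] hv; first exact: E0.
  have [p0 p1] := validL hv x.
  rewrite -[g]mul1r -p1 mulr_suml ES; apply: ler_sum => z _.
  by rewrite ler_wpM2l // -[g]add0r lerD ?ler0n.
elim=> [|t IH] hv W le_t.
  move: le_t; rewrite leqn0 cards_eq0 => /eqP ->.
  by rewrite cards0 big_set0 mul0r addr0.
have [->|[z0 z0W]] := set_0Vmem W; first by rewrite cards0 big_set0 mul0r addr0.
have [p0 p1] := validL hv x.
under eq_bigr do rewrite ES.
rewrite exchange_big /=; set rhs := (X in X <= _).
rewrite -[rhs]mul1r -[X in X * rhs]p1 mulr_suml; apply: ler_sum => yh _.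
rewrite -mulr_sumr ler_wpM2l //.
(* Only [z] can be the guessed label. All other labels of [W] count a mistake and lead to the same
   history, to which the induction hypothesis applies. *)
pose z := if yh \in W then yh else z0.
have zW : z \in W by rewrite /z; case: ifP.
have neq_yh y : y \in W -> y != z -> yh != y.
  move=> yW; rewrite /z; case: ifP => [_|/negbT yhW _]; first by rewrite eq_sym.
  by apply: contraNneq yhW => ->.
rewrite (bigD1 z) //=.
have le_z : g <= (yh != z)%:R + E t (rcons hv (x, yh, yh == z)) z.
  by rewrite -[g]add0r lerD ?ler0n.
have cardW : #|W| = #|W :\ z|.+1 by rewrite (cardsD1 z W) zW.
have le_rest := IH (rcons hv (x, yh, false)) (W :\ z).
have -> : \sum_(y in W | y != z)
     ((yh != y)%:R + E t (rcons hv (x, yh, yh == y)) y) =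
   #|W :\ z|%:R + \sum_(y in W :\ z) E t (rcons hv (x, yh, false)) y.
  rewrite -sumr_const -big_split /=; apply: eq_big => [y|y /andP[yW yz]].
    by rewrite !inE andbC.
  by have /negbTE -> := neq_yh y yW yz.
have := le_rest ltac:(lia).
rewrite /rhs cardW binS bin1 natrD -natr1; lra.
Qed.

Fixpoint blocks n k (X : nat -> inst n k) (j : nat) (ys : seq 'I_k) :=
  if ys is y :: ys' then nseq k (X j, y) ++ blocks X j.+1 ys' else [::].

Lemma avg_blocks n k (L : learner n k) (X : nat -> inst n k) j m hv : (0 < k)%N ->
  valid_learner L ->
  m%:R * ((k%:R - 1) / 2) <=
    avg m (fun ys => exp_mistakes_obl L hv (blocks X j ys)).
Proof.
move=> k0 validL; elim: m j hv => [|m IH] j hv; first by rewrite mul0r.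
(* The value with [t] repetitions of the current label left, averaged over the later labels. *)
pose E t hv y := avg m (fun ys =>
  exp_mistakes_obl L hv (nseq t (X j, y) ++ blocks X j.+1 ys)).
have := @block_lower n k L (X j) (m%:R * ((k%:R - 1) / 2)) E validL
  (fun hv _ => IH _ hv).
have ES t hv' y : E t.+1 hv' y = \sum_yh L hv' (X j) yh *
    ((yh != y)%:R + E t (rcons hv' (X j, yh, yh == y)) y).
  exact: (avg_linear m (L hv' (X j)) _ (fun yh ys => exp_mistakes_obl L
    (rcons hv' (X j, yh, yh == y)) (nseq t (X j, y) ++ blocks X j.+1 ys)) k0).
move=> /(_ ES k hv [set: 'I_k]); rewrite cardsT card_ord => /(_ (leqnn k)).
rewrite (eq_bigl (fun=> true)) => [|y]; last by rewrite inE.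
have : (k%:R * (k%:R - 1) = 2 * ('C(k, 2))%:R :> R).
  rewrite -natrM -mul_bin_diag bin1 natrM; congr (_ * _).
  by rewrite -[in LHS](prednK k0) -natr1 addrK.
have k0R : 0 < k%:R :> R by rewrite ltr0n.
move=> eqC le_E /=; rewrite ler_pdivlMl // -natr1; apply: le_trans le_E.
by lra.
Qed.

Definition digit_inst n k (k0 : (0 < k)%N) (j : nat) : inst n k :=
  [ffun i : 'I_n => Ordinal (ltn_pmod (i %/ k ^ j) k0)].

(** Little-endian base [k]: the first block determines the lowest digit of the index. *)
Definition code k (ys : seq 'I_k) : nat :=
  foldr (fun (y : 'I_k) c => (y + k * c)%N) 0%N ys.

Lemma code_lt k (ys : seq 'I_k) : (code ys < k ^ size ys)%N.
Proof.
elim: ys => [|y ys IH] //=; have := ltn_ord y; rewrite expnS; nia.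
Qed.

(** Dividing by [k ^ j] discards the digits already presented, so each step reads the lowest
    remaining one. *)
Lemma digit_blocks_realized n k (k0 : (0 < k)%N) (i : 'I_n) j ys :
  (i %/ k ^ j)%N = code ys ->
  all (fun e => expert i e.1 == e.2) (blocks (digit_inst n k0) j ys).
Proof.
elim: ys j => [|y ys IH] j //= eq_code; rewrite all_cat; apply/andP; split.
  rewrite all_nseq; apply/orP; right; rewrite /expert ffunE -val_eqE /= eq_code.
  by rewrite addnC mulnC modnMDl modn_small.
apply: IH; rewrite expnSr divnMA eq_code addnC mulnC divnMDl //.
by rewrite divn_small ?addn0.
Qed.

Lemma hard_sequence n k (L : learner n k) : (1 < k)%N -> (k <= n)%N ->
  valid_learner L ->
  exists S (i : 'I_n), all (fun e => expert i e.1 == e.2) S /\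
    k%:R * logb k n / 8 <= exp_mistakes_obl L [::] S.
Proof.
move=> k1 kn validL; have k0 : (0 < k)%N by lia.
have n0 : (0 < n)%N by lia.
pose m := trunc_log k n.
have m1 : (0 < m)%N by rewrite trunc_log_gt0 k1 /=; lia.
have [ys [sz le_ys]] := exists_ge_avg k0
  (avg_blocks (digit_inst n k0) 0 m [::] k0 validL).
have code_n : (code ys < n)%N.
  by apply: leq_trans (trunc_logP k1 n0); rewrite -/m -sz code_lt.
exists (blocks (digit_inst n k0) 0 ys), (Ordinal code_n); split.
  by apply: digit_blocks_realized; rewrite expn0 divn1.
apply: le_trans le_ys.
have l0 := ln_nat_gt0 k1.
(* With [log_k n <= m + 1 <= 2 m] and [k - 1 >= k / 2], the bound [m (k - 1) / 2] yields the
   constant [1 / 8]. *)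
have log_le : logb k n <= m%:R + 1.
  rewrite /logb ler_pdivrMr // natr1 mulr_natl -lnXn ?ltr0n //.
  rewrite ler_ln ?posrE -?natrX ?ltr0n ?expn_gt0 ?k0 // ler_nat.
  by rewrite ltnW // trunc_log_ltn.
have k2 : 2 <= k%:R :> R by rewrite ler_nat.
have m1R : 1 <= m%:R :> R by rewrite ler1n.
have : k%:R * logb k n <= k%:R * (m%:R + 1) by rewrite ler_wpM2l //; lra.
nra.
Qed.

Lemma opt_obl_ge n k r : (1 < k)%N -> (k <= n)%N ->
  ((k%:R * logb k n / 8)%:E <= opt_obl n k r)%E.
Proof.
move=> k1 kn; apply: le_ereal_inf_tmp => _ [L validL <-].
have [S [i [good le_S]]] := hard_sequence k1 kn validL.
apply: (@le_trans _ _ (exp_mistakes_obl L [::] S)%:E); first by rewrite lee_fin.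
apply: ereal_sup_ubound; exists S => //; exists i.
have := has_predC (fun e => expert i e.1 == e.2) S.
by rewrite good has_count lt0n => /negbFE/eqP ->.
Qed.

(** * Adaptive adversaries *)

Definition survives n k r (h : seq (fobs n k)) : bool :=
  [exists i, charges i (view h) <= r]%N.

Lemma survivesP n k r (h : seq (fobs n k)) : (1 < k)%N ->
  realizable r (view h) <-> survives r h.
Proof.
move=> k1; split=> [/(realizableP _ _ k1)[i le_r]|/existsP[i le_r]].
  by apply/existsP; exists i.
by apply/realizableP => //; exists i.
Qed.

Lemma charges_truthful n k (i : 'I_n) (h : seq (fobs n k)) (x : inst n k) yh :
  charges i (view (rcons h (x, yh, x i))) = charges i (view h).
Proof.
by rewrite /view map_rcons charges_rcons /inconsistent /= [yh == _]eq_sym eqxx addn0.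
Qed.

(* When a label [y0 h p] could kill the last surviving expert, the adversary
   follows a surviving expert instead, which is then never charged again: this
   makes it valid whatever [X] and [y0] are. *)
Definition guarded n k r (i0 : 'I_n) (X : seq (fobs n k) -> inst n k)
    (y0 : seq (fobs n k) -> {ffun 'I_k -> R} -> 'I_k) : adversary n k :=
  Adversary X (fun h p =>
    if [forall yh, survives r (rcons h (X h, yh, y0 h p))] then dirac (y0 h p)
    else dirac (X h (odflt i0 [pick i | charges i (view h) <= r]%N))).

Lemma guarded_valid n k r i0 X y0 (L : learner n k) : (1 < k)%N ->
  valid_adversary r L (guarded r i0 X y0).
Proof.
move=> k1; split=> [h p|h real_h /=].
  by rewrite /=; case: ifP => _; apply: dirac_is_dist.
set p := L _ _; move=> yh y _; case: ifP => [/forallP safe|_] /dirac_gt0 ->.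
  by apply/survivesP.
apply/survivesP => //; apply/existsP.
case: pickP => [i le_r|none]; first by exists i; rewrite charges_truthful.
by have /(survivesP _ _ k1)/existsP[i] := real_h; rewrite none.
Qed.

Lemma guarded_step n k r i0 X y0 (L : learner n k) T h :
  let p := L (view h) (X h) in
  (forall yh, survives r (rcons h (X h, yh, y0 h p))) ->
  exp_mistakes_adap L (guarded r i0 X y0) T.+1 h =
  \sum_yh p yh * ((yh != y0 h p)%:R +
    exp_mistakes_adap L (guarded r i0 X y0) T (rcons h (X h, yh, y0 h p))).
Proof.
move=> p safe /=; rewrite -/p; have -> : [forall yh,
  survives r (rcons h (X h, yh, y0 h p))] by apply/forallP.
apply: eq_bigr => yh _; under eq_bigr do rewrite -mulrA.
by rewrite -mulr_sumr sum_dirac.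
Qed.

Lemma exp_mistakes_adap_ge0 n k r (L : learner n k) A T h :
  valid_learner L -> valid_adversary r L A -> 0 <= exp_mistakes_adap L A T h.
Proof.
move=> validL [distA _]; elim: T h => [|T IH] h //=.
apply: sumr_ge0 => yh _; apply: sumr_ge0 => y _.
have [p0 _] := validL (view h) (adv_x A h).
have [q0 _] := distA h (L (view h) (adv_x A h)).
by rewrite mulr_ge0 ?addr_ge0 ?mulr_ge0.
Qed.

Lemma opt_adap_ge_guarded n k r v : (1 < k)%N ->
  (forall L : learner n k, valid_learner L ->
     exists i0 X y0 T, v <= exp_mistakes_adap L (guarded r i0 X y0) T [::]) ->
  (v%:E <= opt_adap n k r)%E.
Proof.
move=> k1 lower; apply: le_ereal_inf_tmp => _ [L validL <-].
have [i0 [X [y0 [T le_v]]]] := lower L validL.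
apply: (@le_trans _ _ (exp_mistakes_adap L (guarded r i0 X y0) T [::])%:E).
  by rewrite lee_fin.
apply: ereal_sup_ubound; exists (guarded r i0 X y0, T) => //=.
exact: guarded_valid.
Qed.

(** The adversary replays [S], using [size h] as the position and the predictions of [i] as labels.
    As [i] is never charged, every label is safe and the guard does not interfere. *)
Lemma guarded_simulates n k r (L : learner n k) S i : (0 < k)%N ->
  all (fun e => expert i e.1 == e.2) S ->
  exists i0 X y0, exp_mistakes_adap L (guarded r i0 X y0) (size S) [::] =
    exp_mistakes_obl L [::] S.
Proof.
move=> k0 good.
pose X (h : seq (fobs n k)) := nth [ffun=> Ordinal k0] (map fst S) (size h).
pose y0 (h : seq (fobs n k)) (p : {ffun 'I_k -> R}) := X h i.
exists i, X, y0.
suff sim S' h : drop (size h) S = S' -> charges i (view h) = 0%N ->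
    exp_mistakes_adap L (guarded r i X y0) (size S') h =
    exp_mistakes_obl L (view h) S'.
  by apply: sim; rewrite ?drop0.
elim: S' h => [//|[x y] S' IH] h drop_S no_charge.
have lt_h : (size h < size S)%N.
  by rewrite ltnNge; apply/negP => /drop_oversize; rewrite drop_S.
have := drop_nth (x, y) lt_h; rewrite drop_S => -[eq_nth eq_S'].
have Xh : X h = x by rewrite /X (nth_map (x, y)) // -eq_nth.
have xi : x i = y.
  by have /allP/(_ _ (mem_nth (x, y) lt_h)) := good; rewrite -eq_nth => /eqP.
have no_charge' yh : charges i (view (rcons h (X h, yh, X h i))) = 0%N.
  by rewrite charges_truthful.
rewrite [size _]/= guarded_step => [|yh]; last first.
  by apply/existsP; exists i; rewrite no_charge'.
rewrite /= {1 3}/y0; apply: eq_bigr => yh _.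
rewrite IH ?no_charge' ?size_rcons // /y0 Xh xi; congr (_ * (_ + _)).
by rewrite /view map_rcons.
Qed.

Lemma opt_adap_ge_log n k r : (1 < k)%N -> (k <= n)%N ->
  ((k%:R * logb k n / 8)%:E <= opt_adap n k r)%E.
Proof.
move=> k1 kn; apply: opt_adap_ge_guarded => // L validL.
have [S [i [good le_S]]] := hard_sequence k1 kn validL.
have [i0 [X [y0 sim]]] := guarded_simulates r L (ltnW k1) good.
by exists i0, X, y0, (size S); rewrite sim.
Qed.

(** * The lower bound in [r], by counting charges to [k] experts *)

Lemma exists_unlikely k (p : {ffun 'I_k -> R}) : (0 < k)%N -> is_dist p ->
  exists y, p y <= k%:R^-1.
Proof.
move=> k0 [_ p1]; have [y le_y|lt_p] := pickP (fun y => p y <= k%:R^-1).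
  by exists y.
suff : \sum_(y : 'I_k) k%:R^-1 < \sum_y p y.
  by rewrite p1 sum_const_ord divff ?ltxx // pnatr_eq0; lia.
apply: ltr_sum => [|y _]; last by rewrite ltNge lt_p.
by apply/hasP; exists (Ordinal k0) => //; rewrite mem_index_enum.
Qed.

Definition sum_charges n k (kn : (k <= n)%N) (h : seq (fobs n k)) : nat :=
  \sum_(j < k) charges (widen_ord kn j) (view h).

(** The predictions are distinct: a correct guess contradicts all of the [k] experts but one, a
    wrong guess exactly one. *)
Lemma sum_charges_rcons n k (kn : (k <= n)%N) (h : seq (fobs n k))
    (x : inst n k) yh y :
  (forall j, x (widen_ord kn j) = j) ->
  sum_charges kn (rcons h (x, yh, y)) =
  (sum_charges kn h + (if yh == y then k.-1 else 1))%N.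
Proof.
move=> xE; rewrite /sum_charges.
under eq_bigr => j do rewrite /view map_rcons charges_rcons /inconsistent /= xE.
rewrite big_split /=; congr (_ + _)%N; case: (yh == y).
  have := cardC1 yh; rewrite card_ord => <-; rewrite -sum1_card [RHS]big_mkcond.
  by apply: eq_bigr => j _; rewrite inE /=; case: (j == yh).
rewrite -[RHS](card1 yh) -sum1_card [RHS]big_mkcond.
by apply: eq_bigr => j _; rewrite inE /=; case: (j == yh).
Qed.

(** Pigeonhole: eliminating the [k] experts takes at least [r + 1] charges to each. *)
Lemma survives_sum_charges n k r (kn : (k <= n)%N) (h : seq (fobs n k)) :
  (sum_charges kn h < k * r.+1)%N -> survives r h.
Proof.
apply: contraTT => /existsPn dead; rewrite -leqNgt -{1}[k]card_ord -sum_nat_const.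
by apply: leq_sum => j _; rewrite ltnNge dead.
Qed.

(* Every round adds at least one charge to the sum over the [k] experts, so
   [k r + 1] rounds exhaust the budget, whatever the guesses. *)
Lemma opt_adap_ge_budget n k r : (1 < k)%N -> (k <= n)%N ->
  ((k%:R * r%:R / 4)%:E <= opt_adap n k r)%E.
Proof.
move=> k1 kn; have k0 : (0 < k)%N by lia.
apply: opt_adap_ge_guarded => // L validL.
have i0 : 'I_n := Ordinal (leq_trans k0 kn).
pose x0 : inst n k := [ffun i : 'I_n => insubd (Ordinal k0) (val i)].
have x0E j : x0 (widen_ord kn j) = j.
  by apply: val_inj; rewrite ffunE val_insubd /= ltn_ord.
pose X (h : seq (fobs n k)) := x0.
pose y0 (h : seq (fobs n k)) (p : {ffun 'I_k -> R}) :=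
  odflt (Ordinal k0) [pick y | p y <= k%:R^-1].
exists i0, X, y0, (k * r).+1.
suff claim T h : ((k * r).+1 <= T + sum_charges kn h)%N ->
    ((k * r).+1%:R - (sum_charges kn h)%:R) / 4 <=
    exp_mistakes_adap L (guarded r i0 X y0) T h.
  apply: le_trans (claim _ [::] _); last by rewrite leq_addr.
  have -> : sum_charges kn (Nil (fobs n k)) = 0%N by apply: big1.
  by rewrite -[(k * r).+1%:R]natr1 natrM; lra.
elim: T h => [|T IH] h le_T.
  by rewrite /= pmulr_lle0 // subr_le0 ler_nat.
have [le_Q|lt_Q] := leqP (k * r).+1 (sum_charges kn h).
  apply: (@le_trans _ _ 0).
    by rewrite pmulr_lle0 // subr_le0 ler_nat.
  exact: exp_mistakes_adap_ge0 (guarded_valid r i0 X y0 L k1).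
set p := L (view h) (X h).
have [p0 p1] : is_dist p by apply: validL.
have py : p (y0 h p) <= k%:R^-1.
  rewrite /y0; case: pickP => [//|none].
  by have [y] := exists_unlikely k0 (validL (view h) (X h)); rewrite -/p none.
rewrite guarded_step -/p => [|yh]; last first.
  (* At most [k r] charges precede the round and it adds at most [k - 1], so the sum stays below
     [k (r + 1)]. *)
  apply: (survives_sum_charges (kn := kn)); rewrite sum_charges_rcons //.
  by rewrite mulnS; case: ifP => _; lia.
set y := y0 h p in py *.
pose A : R := (k * r).+1%:R - (sum_charges kn h)%:R.
(* The factor [1 / 4]: on average a round costs at least half a mistake and adds at most two
   charges. *)
apply: (@le_trans _ _ (\sum_yh p yh *
    ((yh != y)%:R + (A - (if yh == y then k.-1 else 1)%:R) / 4))).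
  rewrite -/A; rewrite (bigD1 y) //= eqxx add0r.
  rewrite [X in _ + X](eq_bigr (fun yh => p yh * ((A + 3) / 4))); last first.
    by move=> z /negbTE ->; congr (_ * _); rewrite /=; lra.
  have := p1; rewrite -mulr_suml (bigD1 y) //= => /(canRL (addKr _)) ->.
  have : p y * k%:R <= 1 by rewrite -ler_pdivlMr ?mul1r ?ltr0n.
  have py_half : p y <= 2^-1.
    by apply: le_trans py _; rewrite lef_pV2 ?posrE ?ltr0n ?ler_nat.
  have -> : k.-1%:R = k%:R - 1 :> R by rewrite -[in RHS](prednK k0) -natr1 addrK.
  nra.
apply: ler_sum => yh _; rewrite ler_wpM2l // lerD2l.
apply: le_trans (IH _ _); rewrite sum_charges_rcons //; last first.
  by case: ifP => _; lia.
by rewrite natrD opprD addrA.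
Qed.

(** * Combination of the bounds *)

Local Open Scope ereal_scope.

Theorem theorem4p12 :
  (exists c C : R, (0 < c)%R /\ (c <= C)%R /\
     forall n k r : nat, (2 <= k)%N -> (k <= n)%N ->
       ((c * k%:R * (logb k n + r%:R))%:E <= opt_adap n k r /\
        opt_adap n k r <= (C * k%:R * (logb k n + r%:R))%:E)) /\
  (forall C0 : R, (0 < C0)%R ->
     exists c' C' : R, (0 < c')%R /\ (c' <= C')%R /\
       forall n k r : nat, (2 <= k)%N -> (k <= n)%N ->
         (r%:R <= C0 * logb k n)%R ->
         ((c' * k%:R * logb k n)%:E <= opt_obl n k r /\
          opt_obl n k r <= (C' * k%:R * logb k n)%:E)).
Proof.
split.
  (* The larger of [log_k n] and [r] is at least half their sum, which halves the smaller lower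
     constant [1 / 8]. *)
  exists (16^-1)%R, 4%R; split; [lra|split; [lra|]] => n k r k1 kn.
  have n0 : (0 < n)%N by lia.
  split; last exact: opt_adap_le.
  have [le_r|le_log] := lerP (logb k n) r%:R.
    apply: le_trans (opt_adap_ge_budget r k1 kn); rewrite lee_fin.
    have : (k%:R * logb k n <= k%:R * r%:R)%R by rewrite ler_wpM2l.
    have : (0 <= k%:R * r%:R :> R)%R by rewrite mulr_ge0.
    lra.
  apply: le_trans (opt_adap_ge_log r k1 kn); rewrite lee_fin.
  have : (k%:R * r%:R <= k%:R * logb k n)%R by rewrite ler_wpM2l // ltW.
  lra.
(* Here [log_k n + r <= (1 + C0) log_k n] in the upper bound [4 k (log_k n + r)]. *)
move=> C0 C0_gt0; exists (8^-1)%R, (4 * (1 + C0))%R.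
split; [lra|split; [lra|]] => n k r k1 kn le_r; have n0 : (0 < n)%N by lia.
split; first by apply: le_trans (opt_obl_ge r k1 kn); rewrite lee_fin; lra.
apply: le_trans (opt_obl_le r k1 n0) _; rewrite lee_fin.
rewrite -[(4 * (1 + C0) * _)%R]mulrA -[X in (_ <= X)%R]mulrA.
have : (k%:R * r%:R <= k%:R * (C0 * logb k n))%R by rewrite ler_wpM2l.
lra.
Qed.
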